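(* Let $A\in\mathbb{R}^{m\times n}$ be a full column-rank matrix. Then $$\chi(A)=\max_{S\in\mathscr{S}} H(SA).$$
   Context: Here $m,n\ge 1$; $\mathbb{R}^d$ carries the Euclidean norm $\|\cdot\|$ and matrices carry the induced operator norm $\|M\|=\max_{\|x\|\le 1}\|Mx\|$. $\mathbb{R}^m_+$ and $\mathbb{R}^m_{++}$ are the sets of vectors in $\mathbb{R}^m$ with nonnegative, respectively positive, entries. $\mathscr{S}:=\{\operatorname{Diag}(s): s\in\{-1,1\}^m\}\subseteq\mathbb{R}^{m\times m}$ is the set of signature matrices and $\mathscr{D}:=\{\operatorname{Diag}(d): d\in\mathbb{R}^m_{++}\}$ is the set of diagonal matrices with positive diagonal entries. Chi constant: for $A\in\mathbb{R}^{m\times n}$ of full column rank and $D\in\mathscr{D}$, let $A_D^\dagger:=(A^{\mathsf T}DA)^{-1}A^{\mathsf T}D$, and define $$\chi(A):=\sup_{D\in\mathscr{D}}\|A_D^\dagger\|,$$ which is known to be finite. Hoffman constant: for a nonzero $A\in\mathbb{R}^{m\times n}$ and $b\in\mathbb{R}^m$ let $P_A(b):=\{x\in\mathbb{R}^n: Ax\le b\}$ (componentwise inequality), which is nonempty if and only if $b\in A(\mathbb{R}^n)+\mathbb{R}^m_+$. Define $$H(A):=\sup\left\{\frac{\operatorname{dist}(x,P_A(b))}{\|(Ax-b)_+\|}: b\in A(\mathbb{R}^n)+\mathbb{R}^m_+,\ x\in\mathbb{R}^n\setminus P_A(b)\right\},$$ which is known to be finite, where $\operatorname{dist}(u,T)=\inf_{v\in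 T}\|u-v\|$ and $(\cdot)_+$ is the componentwise positive part. *)

(* Defs.v *)
From mathcomp Require Import all_boot all_order all_algebra.
From mathcomp Require Import all_classical all_reals all_analysis.
Set Implicit Arguments.
Unset Strict Implicit.
Unset Printing Implicit Defensive.
Import Order.TTheory GRing.Theory Num.Theory.
Local Open Scope classical_set_scope.
Local Open Scope ring_scope.

(* The norm `|x| that the library puts on matrices is the max norm, hence the
   explicit Euclidean norm. *)
Definition norm2 (R : realType) (d : nat) (x : 'cV[R]_d) : R :=
  Num.sqrt (\sum_i x i 0 ^+ 2).

(* The set below is nonempty and bounded above, so [sup] is its true supremum;
   by compactness of the unit ball it is a maximum. *)
Definition opnorm (R : realType) (p q : nat) (M : 'M[R]_(p, q)) : R :=
  sup [set norm2 (M *m x) | x in [set x : 'cV[R]_q | norm2 x <= 1]].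

(* The real [inf] is the true infimum as soon as T is nonempty. *)
Definition dist (R : realType) (d : nat) (u : 'cV[R]_d) (T : set 'cV[R]_d) : R :=
  inf [set norm2 (u - v) | v in T].

Definition pospart (R : realType) (d : nat) (y : 'cV[R]_d) : 'cV[R]_d :=
  \col_i Num.max (y i 0) 0.

Definition nonneg_orthant (R : realType) (m : nat) : set 'cV[R]_m :=
  [set z | forall i, 0 <= z i 0].
Arguments nonneg_orthant : clear implicits.

Definition signature_mxs (R : realType) (m : nat) : set 'M[R]_m :=
  [set diag_mx s | s in [set s : 'rV[R]_m | forall i, s 0 i = -1 \/ s 0 i = 1]].
Arguments signature_mxs : clear implicits.

Definition posdiag_mxs (R : realType) (m : nat) : set 'M[R]_m :=
  [set diag_mx d | d in [set d : 'rV[R]_m | forall i, 0 < d 0 i]].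
Arguments posdiag_mxs : clear implicits.

(* When A has full column rank and D is positive diagonal, A^T D A is invertible,
   so [invmx] is the true inverse. *)
Definition weighted_pinv (R : realType) (m n : nat) (A : 'M[R]_(m, n))
    (D : 'M[R]_m) : 'M[R]_(n, m) :=
  invmx (A^T *m D *m A) *m A^T *m D.

(* The suprema defining [chi] and [hoffman] are taken in the extended reals, so
   that they carry no default value for unbounded sets. *)
Definition chi (R : realType) (m n : nat) (A : 'M[R]_(m, n)) : \bar R :=
  ereal_sup [set (opnorm (weighted_pinv A D))%:E | D in posdiag_mxs R m].

Definition polyhedron (R : realType) (m n : nat) (A : 'M[R]_(m, n))
    (b : 'cV[R]_m) : set 'cV[R]_n :=
  [set x | forall i, (A *m x) i 0 <= b i 0].

Definition feasible_rhs (R : realType) (m n : nat) (A : 'M[R]_(m, n)) :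
    set 'cV[R]_m :=
  [set b | exists x : 'cV[R]_n, exists2 z, nonneg_orthant R m z & b = A *m x + z].

(* b ranges over the right-hand sides for which the polyhedron is nonempty, and
   the denominator is nonzero because x lies outside the polyhedron. *)
Definition hoffman (R : realType) (m n : nat) (A : 'M[R]_(m, n)) : \bar R :=
  ereal_sup [set r | exists b : 'cV[R]_m, exists x : 'cV[R]_n,
    [/\ feasible_rhs A b, ~ polyhedron A b x &
        r = (dist x (polyhedron A b) / norm2 (pospart (A *m x - b)))%:E]].

Definition is_max (R : realType) (E : set (\bar R)) (y : \bar R) : Prop :=
  E y /\ ubound E y.

(* Main.v *)
(* Both constants are controlled by the single inequality |mu| <= c |A^T mu| for
   mu = D A v, D positive diagonal, which says |(A_D^+)^T| <= c and is invariant
   under A -> SA.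

   H(SA) <= chi(A): a penalised projection z of x onto {A z <= b} satisfies
   x - z = A^T l with l >= 0 supported on constraints violated at z, so that
   |x - z|^2 <= <l, (A x - b)_+>. By Caratheodory, l may be taken supported on
   linearly independent rows; then l agrees with some A v on its support and is
   a limit of vectors D A v, whence |l| <= c |x - z|. Letting the penalty weight
   tend to 0 gives dist(x, P) <= c |(A x - b)_+|.

   chi(A) <= max_S H(SA): each |A_D^+ y| with |y| <= 1 is bounded by a Hoffman
   ratio of S A at b = 0, for signs read off the residual y - A A_D^+ y. *)

Require Import Defs.
From mathcomp Require Import all_boot all_order all_algebra.
From mathcomp Require Import all_classical all_reals all_analysis.
From mathcomp Require Import ring lra.
Import Order.TTheory GRing.Theory Num.Theory numFieldNormedType.Exports.
Local Open Scope classical_set_scope.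
Local Open Scope ring_scope.

(** * Inner product and Euclidean norm *)

Definition dot {R : realType} {d : nat} (u v : 'cV[R]_d) : R :=
  \sum_i u i 0 * v i 0.

Section Euclid.
Context {R : realType} {d : nat}.
Implicit Types u v w : 'cV[R]_d.

Lemma dotC u v : dot u v = dot v u.
Proof. by apply: eq_bigr => i _; rewrite mulrC. Qed.

Lemma dotDl u v w : dot (u + v) w = dot u w + dot v w.
Proof. by rewrite -big_split; apply: eq_bigr => i _; rewrite mxE mulrDl. Qed.

Lemma dotZl k u v : dot (k *: u) v = k * dot u v.
Proof. by rewrite mulr_sumr; apply: eq_bigr => i _; rewrite mxE mulrA. Qed.

Lemma dotNl u v : dot (- u) v = - dot u v.
Proof. by rewrite -scaleN1r dotZl mulN1r. Qed.

Lemma dotDr u v w : dot w (u + v) = dot w u + dot w v.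
Proof. by rewrite dotC dotDl !(dotC w). Qed.

Lemma dotZr k u v : dot u (k *: v) = k * dot u v.
Proof. by rewrite dotC dotZl dotC. Qed.

Lemma dotNr u v : dot u (- v) = - dot u v.
Proof. by rewrite dotC dotNl dotC. Qed.

Lemma dot0l u : dot 0 u = 0.
Proof. by rewrite -(scale0r u) dotZl mul0r. Qed.

Lemma dotvv_ge0 u : 0 <= dot u u.
Proof. by apply: sumr_ge0 => i _; rewrite -expr2 sqr_ge0. Qed.

Lemma dotvv_eq0 u : dot u u = 0 -> u = 0.
Proof.
move=> /eqP; rewrite psumr_eq0 => [/allP u0|i _]; last by rewrite -expr2 sqr_ge0.
apply/colP => i; rewrite mxE; apply/eqP.
by have := u0 i (mem_index_enum i); rewrite mulf_eq0 orbb.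
Qed.

Lemma le_dot u u' v v' : (forall i, u i 0 * v i 0 <= u' i 0 * v' i 0) ->
  dot u v <= dot u' v'.
Proof. by move=> h; apply: ler_sum => i _. Qed.

Lemma norm2_ge0 u : 0 <= norm2 u.
Proof. exact: sqrtr_ge0. Qed.

Lemma norm2_sqr u : norm2 u ^+ 2 = dot u u.
Proof.
have duu : dot u u = \sum_i u i 0 ^+ 2 by apply: eq_bigr => i _; rewrite expr2.
by rewrite /norm2 -duu sqr_sqrtr ?dotvv_ge0.
Qed.

Lemma norm2_eq0 u : (norm2 u == 0) = (u == 0).
Proof.
apply/eqP/eqP => [u0|->].
  by apply: dotvv_eq0; rewrite -norm2_sqr u0 expr0n.
by apply/eqP; rewrite -sqrf_eq0 norm2_sqr dot0l.
Qed.

Lemma norm20 : norm2 (0 : 'cV[R]_d) = 0.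
Proof. by apply/eqP; rewrite norm2_eq0. Qed.

Lemma norm2_le u c : 0 <= c -> (norm2 u <= c) = (dot u u <= c ^+ 2).
Proof. by move=> c0; rewrite -norm2_sqr ler_pXn2r// nnegrE norm2_ge0. Qed.

Lemma le_norm2 u v : dot u u <= dot v v -> norm2 u <= norm2 v.
Proof. by rewrite norm2_le ?norm2_ge0// norm2_sqr. Qed.

Lemma norm2Z k u : norm2 (k *: u) = `|k| * norm2 u.
Proof.
apply/eqP; rewrite -(@eqrXn2 _ 2)// ?mulr_ge0 ?norm2_ge0//.
by rewrite norm2_sqr dotZl dotZr exprMn norm2_sqr real_normK ?num_real// expr2 mulrA.
Qed.

Lemma dot_sqr_le u v : dot u v ^+ 2 <= dot u u * dot v v.
Proof.
have [->|v0] := eqVneq v 0; first by rewrite !(dotC _ 0) !dot0l mulr0 expr0n.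
(* This vector is |v|^2 times the component of u orthogonal to v; its squared norm is |v|^2 (|u|^2
   |v|^2 - (u.v)^2). *)
have := dotvv_ge0 (dot v v *: u - dot u v *: v).
rewrite !(dotDl, dotDr, dotNl, dotNr, dotZl, dotZr) (dotC v u) => h.
have b0 : 0 < dot v v.
  by rewrite lt0r dotvv_ge0 andbT; apply: contra_neq v0; exact: dotvv_eq0.
rewrite -subr_ge0 -(pmulr_rge0 _ b0); apply: le_trans h _.
by rewrite le_eqVlt; apply/orP; left; apply/eqP; ring.
Qed.

Lemma cauchy_schwarz u v : dot u v <= norm2 u * norm2 v.
Proof.
apply: le_trans (ler_norm _) _.
rewrite -(ler_pXn2r (n:=2)) ?nnegrE ?mulr_ge0 ?norm2_ge0 ?normr_ge0//.
by rewrite real_normK ?num_real// exprMn !norm2_sqr dot_sqr_le.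
Qed.

Lemma ler_norm2D u v : norm2 (u + v) <= norm2 u + norm2 v.
Proof.
rewrite norm2_le ?addr_ge0 ?norm2_ge0// !(dotDl, dotDr) (dotC v u) sqrrD.
by rewrite !norm2_sqr; have := cauchy_schwarz u v; lra.
Qed.

End Euclid.

Lemma dot_mulmx {R : realType} {m n : nat} (M : 'M[R]_(m, n)) u v :
  dot (M^T *m u) v = dot u (M *m v).
Proof.
rewrite /dot.
under eq_bigr do rewrite mxE mulr_suml.
under [RHS]eq_bigr do rewrite mxE mulr_sumr.
rewrite exchange_big; apply: eq_bigr => i _; apply: eq_bigr => j _ /=.
by rewrite mxE mulrCA mulrA.
Qed.

Lemma sqr_le_dot {R : realType} {d : nat} (u : 'cV[R]_d) i : u i 0 ^+ 2 <= dot u u.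
Proof.
rewrite /dot (bigD1 i)//= expr2 lerDl; apply: sumr_ge0 => j _.
by rewrite -expr2 sqr_ge0.
Qed.

(** * Continuity, and minimisation over Euclidean balls *)

Section Continuity.
Context {R : realType} {T : topologicalType}.

Lemma continuous_sum {I : Type} (r : seq I) (F : I -> T -> R) :
  (forall i, continuous (F i)) -> continuous (fun t => \sum_(i <- r) F i t).
Proof.
move=> Fc; apply: continuous_big => // t.
exact: add_continuous.
Qed.

Lemma continuous_dot {d : nat} (F G : T -> 'cV[R]_d) :
  (forall i, continuous (fun t => F t i 0)) ->
  (forall i, continuous (fun t => G t i 0)) ->
  continuous (fun t => dot (F t) (G t)).
Proof.
by move=> Fc Gc; apply: continuous_sum => i t; apply: cvgM; [exact: Fc|exact: Gc].
Qed.

Lemma continuous_affine {I : Type} (r : seq I) (a : I -> R) (F : I -> T -> R) b :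
  (forall i, continuous (F i)) ->
  continuous (fun t => \sum_(i <- r) a i * F i t - b).
Proof.
move=> Fc t; apply: cvgB; last exact: cvg_cst.
by move: t; apply: continuous_sum => i t; apply: cvgM; [exact: cvg_cst|exact: Fc].
Qed.

Lemma continuous_addZ (e : R) (f g : T -> R) :
  continuous f -> continuous g -> continuous (fun t => e * f t + g t).
Proof.
move=> fc gc t; apply: cvgD; last exact: gc.
by apply: cvgM; [exact: cvg_cst|exact: fc].
Qed.

End Continuity.

Lemma continuous_affine_tr {R : realType} {m n : nat} (M : 'M[R]_(m, n)) b i :
  continuous (fun v : 'rV[R]_n => (M *m v^T - b) i 0).
Proof.
have -> : (fun v : 'rV[R]_n => (M *m v^T - b) i 0) =
    (fun v => \sum_j M i j * v 0 j - b i 0).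
  apply/funext => v; rewrite !mxE; congr (_ - _).
  by apply: eq_bigr => j _; rewrite mxE.
apply: continuous_affine => j; exact: coord_continuous.
Qed.

Lemma continuous_sub_tr {R : realType} {n : nat} (x : 'cV[R]_n) i :
  continuous (fun v : 'rV[R]_n => (x - v^T) i 0).
Proof.
have -> : (fun v : 'rV[R]_n => (x - v^T) i 0) =
    (fun v => (- 1%:M *m v^T - - x) i 0).
  by apply/funext => v; rewrite mulNmx mul1mx opprK addrC.
exact: continuous_affine_tr.
Qed.

(* The objective is written on row vectors because compactness is only available
   for 'rV in the library. *)
Lemma ball_argmin {R : realType} {n : nat} (f : 'cV[R]_n -> R) (x : 'cV[R]_n)
    (r : R) :
  0 <= r -> continuous (fun v : 'rV[R]_n => f v^T) ->
  exists2 z, norm2 (x - z) <= r & forall w, norm2 (x - w) <= r -> f z <= f w.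
Proof.
move=> r0 fc.
pose B := [set v : 'rV[R]_n | dot (x - v^T) (x - v^T) <= r ^+ 2].
have BE w : B w^T <-> norm2 (x - w) <= r by rewrite /B/= trmxK norm2_le.
have [|||c /set_mem cB cmin] := @EVT_min_rV R n (fun v => f v^T) B.
- by exists x^T; apply/BE; rewrite subrr norm20.
(* The ball is compact as a closed subset of a product of segments. *)
- pose box := [set v : 'rV[R]_n |
    forall i, `[x i 0 - r, x i 0 + r]%classic (v ord0 i)].
  have box_compact : compact box.
    apply: (@rV_compact R n (fun i => `[x i 0 - r, x i 0 + r]%classic)) => i.
    exact: segment_compact.
  apply: subclosed_compact box_compact _ => [|v vB i /=].
    apply: (@preimage_closed _ _ (fun v : 'rV[R]_n => dot (x - v^T) (x - v^T))
        [set t | t <= r ^+ 2]); last exact: closed_le.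
    by move=> v _; apply: continuous_dot => i; exact: continuous_sub_tr.
  have := le_trans (sqr_le_dot (x - v^T) i) vB.
  rewrite -(real_normK (num_real _)) ler_pXn2r ?nnegrE// !mxE distrC ler_distl.
  by rewrite in_itv.
- exact: continuous_subspaceT.
exists c^T; first by apply/BE; rewrite trmxK.
by move=> w wB; rewrite -[w]trmxK; apply: cmin; rewrite inE; apply/BE.
Qed.

(** * Penalised projection onto a polyhedron *)

Lemma linear_coef_eq0 {R : realType} (a k : R) :
  0 <= k -> (forall t, 0 <= 2 * t * a + t ^+ 2 * k) -> a = 0.
Proof.
(* Dividing by k + 1 instead of k covers k = 0; the quadratic is still negative at this t unless a =
   0. *)
move=> k0 /(_ (- a / (k + 1))).
have k1 : k + 1 != 0 by rewrite gt_eqF// ltr_wpDl.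
have -> : 2 * (- a / (k + 1)) * a + (- a / (k + 1)) ^+ 2 * k =
    - (a ^+ 2 * ((k + 2) / (k + 1) ^+ 2)) by field.
rewrite oppr_ge0 pmulr_lle0; last by rewrite divr_gt0 ?exprn_gt0// ltr_wpDl.
by move=> a2; apply/eqP; rewrite -sqrf_eq0 eq_le a2 sqr_ge0.
Qed.

(** The right side is the square of max(a, 0) + t, which dominates a + t. This quadratic upper bound
    stands in for the derivative of max(a, 0)^2 in the optimality condition. *)
Lemma maxr0_sqrD {R : realType} (a t : R) :
  Num.max (a + t) 0 ^+ 2 <= Num.max a 0 ^+ 2 + 2 * t * Num.max a 0 + t ^+ 2.
Proof. by case: (leP (a + t) 0); case: (leP a 0) => ? ?; nra. Qed.

Lemma dot_pospartD {R : realType} {d : nat} (u h : 'cV[R]_d) :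
  dot (pospart (u + h)) (pospart (u + h)) <=
  dot (pospart u) (pospart u) + 2 * dot (pospart u) h + dot h h.
Proof.
rewrite /dot mulr_sumr -!big_split; apply: ler_sum => i _ /=; rewrite !mxE.
have := maxr0_sqrD (u i 0) (h i 0); rewrite !expr2 => /le_trans; apply.
by rewrite le_eqVlt; apply/orP; left; apply/eqP; ring.
Qed.

Lemma pospart_ge0 {R : realType} {d : nat} (u : 'cV[R]_d) i : 0 <= pospart u i 0.
Proof. by rewrite mxE le_max lexx orbT. Qed.

Section Penalty.
Context {R : realType} {m n : nat} (A : 'M[R]_(m, n)) (b : 'cV[R]_m).
Implicit Types (x z : 'cV[R]_n).

Definition excess z := pospart (A *m z - b).

Lemma excessE z i : excess z i 0 = Num.max ((A *m z) i 0 - b i 0) 0.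
Proof. by rewrite mxE mxE [X in _ + X]mxE. Qed.

Lemma polyhedronP z : polyhedron A b z <-> dot (excess z) (excess z) = 0.
Proof.
split=> [zP|/dotvv_eq0 z0 i].
  rewrite (_ : excess z = 0) ?dot0l//; apply/colP => i.
  by rewrite excessE [RHS]mxE; apply: max_r; rewrite subr_le0; exact: zP.
have := congr1 (fun w : 'cV[R]_m => w i 0) z0; rewrite /= excessE [RHS]mxE.
by move=> h; rewrite -subr_le0 -h le_max lexx.
Qed.

Lemma continuous_excess :
  continuous (fun v : 'rV[R]_n => dot (excess v^T) (excess v^T)).
Proof.
have c i : continuous (fun v : 'rV[R]_n => excess v^T i 0).
  have -> : (fun v : 'rV[R]_n => excess v^T i 0) =
      (fun v : 'rV[R]_n => (A *m v^T - b) i 0) \max (fun=> 0).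
    by apply/funext => v; rewrite mxE.
  move=> v; apply: continuous_max; [apply: continuous_affine_tr|exact: cst_continuous].
exact: continuous_dot.
Qed.

(** The point z minimises e |x - z|^2 + |(A z - b)_+|^2: the equation is the vanishing of its
    gradient, the inequality compares its values at z and at p. *)
Lemma penalty_argmin x e (p : 'cV[R]_n) : 0 < e -> polyhedron A b p ->
  exists2 z, e *: (x - z) = A^T *m excess z &
    dot (excess z) (excess z) <= e * dot (x - p) (x - p).
Proof.
move=> e0 /polyhedronP pP.
pose F z := e * dot (x - z) (x - z) + dot (excess z) (excess z).
have [||z zB zmin] := @ball_argmin R n F x (norm2 (x - p)).
- exact: norm2_ge0.
- apply: continuous_addZ; last exact: continuous_excess.
  by apply: continuous_dot => i; exact: continuous_sub_tr.
have Fp : F p = e * dot (x - p) (x - p) by rewrite /F pP addr0.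
have Fz : F z <= F p by apply: zmin.
(* Outside the ball of radius |x - p| the first term of F alone exceeds F p, so the minimum over the
   ball is global. *)
have {}zmin w : F z <= F w.
  have [/zmin//|xpw] := leP (norm2 (x - w)) (norm2 (x - p)).
  apply: le_trans Fz _; rewrite Fp /F -!norm2_sqr -[leLHS]addr0 lerD ?sqr_ge0//.
  by rewrite ler_pM2l// ler_pXn2r ?nnegrE ?norm2_ge0// ltW.
exists z; last first.
  by rewrite -Fp; apply: le_trans Fz; rewrite lerDr mulr_ge0 ?dotvv_ge0// ltW.
(* Half the gradient of F at z. Along z + t g, [dot_pospartD] bounds F from above by a quadratic in
   t with linear coefficient 2 |g|^2, so [linear_coef_eq0] forces g = 0. *)
set g := A^T *m excess z - e *: (x - z).
suff : dot g g = 0 by move/dotvv_eq0/eqP; rewrite subr_eq0 => /eqP.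
apply: (@linear_coef_eq0 _ _ (e * dot g g + dot (A *m g) (A *m g))) => [|t].
  by rewrite addr_ge0 ?mulr_ge0 ?dotvv_ge0// ltW.
have := zmin (z + t *: g).
have -> : F (z + t *: g) = e * dot (x - z) (x - z) - 2 * t * dot (e *: (x - z)) g
    + t ^+ 2 * (e * dot g g)
    + dot (excess (z + t *: g)) (excess (z + t *: g)).
  rewrite /F opprD addrA [in dot _ _](dotDl (x - z)) !(dotDr _ (- (t *: g))).
  rewrite !(dotNl, dotNr, dotZl, dotZr) (dotC g (x - z)); congr (_ + _); ring.
have := dot_pospartD (A *m z - b) (t *: (A *m g)).
have -> : A *m z - b + t *: (A *m g) = A *m (z + t *: g) - b.
  by rewrite (mulmxDr A z) -scalemxAr addrAC.
rewrite -/(excess _) -/(excess z) !(dotZl, dotZr) -dot_mulmx => h1 h2.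
have gg : dot g g = dot (A^T *m excess z) g - e * dot (x - z) g.
  by rewrite -dotZl -dotNl -dotDl.
rewrite /F in h2.
have h3 := le_trans h2 (lerD (lexx _) h1).
rewrite -subr_ge0 in h3; apply: le_trans h3 _.
by rewrite le_eqVlt; apply/orP; left; apply/eqP; rewrite {2}gg; ring.
Qed.

End Penalty.

(** * Conic Caratheodory reduction *)

(** This is linear independence of the rows of A indexed by the support of l. *)
Definition rows_free_on_supp {R : realType} {m n : nat} (A : 'M[R]_(m, n))
    (l : 'cV[R]_m) : Prop :=
  forall k : 'cV[R]_m, (forall i, l i 0 = 0 -> k i 0 = 0) -> A^T *m k = 0 -> k = 0.

(** Induction on the size of the support: as long as its rows admit a nontrivial relation k,
    subtracting a suitable multiple of k removes an index from it. *)
Lemma conic_caratheodory {R : realType} {m n : nat} (A : 'M[R]_(m, n))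
    (l : 'cV[R]_m) : (forall i, 0 <= l i 0) ->
  exists l' : 'cV[R]_m, [/\ (forall i, 0 <= l' i 0),
    (forall i, l i 0 = 0 -> l' i 0 = 0),
    A^T *m l' = A^T *m l & rows_free_on_supp A l'].
Proof.
have [N] := ubnP #|[pred i | l i 0 != 0]|; elim: N l => // N IH l lN l0.
have [fl|] := pselect (rows_free_on_supp A l); first by exists l.
move=> /existsNP [k] /not_implyP [lk] /not_implyP [Ak] /eqP kN0.
wlog [i0 ki0] : k lk Ak kN0 / exists i, 0 < k i 0.
  move=> wl; have [i ki] : exists i, k i 0 != 0.
    apply/existsP; apply: contraNT kN0 => /existsPn k0.
    by apply/eqP/colP => i; rewrite mxE; apply/eqP; have := k0 i; rewrite negbK.
  have [kneg|] := ltP (k i 0) 0.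
    apply: (wl (- k)); first by move=> j /lk kj; rewrite mxE kj oppr0.
    - by rewrite mulmxN Ak oppr0.
    - by rewrite oppr_eq0.
    - by exists i; rewrite mxE oppr_gt0.
  by rewrite le_eqVlt eq_sym (negbTE ki) => kpos; apply: (wl k) => //; exists i.
(* Ratio test: the least ratio over k_i > 0 is the largest step along -k that keeps l nonnegative,
   and it makes the minimising entry vanish. *)
pose r i := l i 0 / k i 0.
have [j kj jmin] : exists2 j, 0 < k j 0 & forall i, 0 < k i 0 -> r j <= r i.
  case: (@arg_minP _ _ _ i0 (fun i => 0 < k i 0) r ki0) => j kj jmin.
  by exists j.
have rj0 : 0 <= r j by rewrite divr_ge0// ltW.
pose l2 := l - r j *: k.
have l2E i : l2 i 0 = l i 0 - r j * k i 0 by rewrite !mxE.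
have supp_l2 i : l i 0 = 0 -> l2 i 0 = 0.
  by move=> li; rewrite l2E li (lk i li) mulr0 subr0.
have l2j : l2 j 0 = 0 by rewrite l2E divfK ?subrr// gt_eqF.
have lj : l j 0 != 0 by apply: contraTneq kj => /lk ->; rewrite ltxx.
have [||l' [l'0 l'supp Al' fl']] := IH l2.
- rewrite -ltnS; apply: leq_trans lN; rewrite ltnS; apply: proper_card.
  apply/properP; split; last by exists j; rewrite !inE ?l2j ?eqxx.
  by apply/fintype.subsetP => i; rewrite !inE; apply: contra => /eqP/supp_l2 ->.
- move=> i; rewrite l2E subr_ge0.
  have [ki|ki] := ltP 0 (k i 0); first by rewrite -ler_pdivlMr// jmin.
  by apply: le_trans (l0 i); rewrite mulr_ge0_le0.
exists l'; split=> //; first by move=> i /supp_l2 /l'supp.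
by rewrite Al' mulmxBr -scalemxAr Ak scaler0 subr0.
Qed.

(** Let P be the coordinate projection onto the support of l. If A^T P K = 0, independence of the
    rows gives P K = 0; taking for K the cokernel of (P A)^T, this puts l = P l in the range of P
    A. *)
Lemma rows_free_interpolation {R : realType} {m n : nat} (A : 'M[R]_(m, n))
    (l : 'cV[R]_m) : rows_free_on_supp A l ->
  exists v : 'cV[R]_n, forall i, l i 0 != 0 -> (A *m v) i 0 = l i 0.
Proof.
move=> fl; pose P : 'M[R]_m := diag_mx (\row_i (l i 0 != 0)%:R).
have PE p (X : 'M[R]_(m, p)) i j : (P *m X) i j = (l i 0 != 0)%:R * X i j.
  by rewrite mul_diag_mx !mxE.
have Pl : P *m l = l.
  apply/colP => i; rewrite PE.
  by have [->|_] := eqVneq (l i 0) 0; rewrite ?mulr0// mul1r.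
have Pt : P^T = P by exact: tr_diag_mx.
pose B := P *m A; pose K := cokermx B^T.
have PK : P *m K = 0.
  apply/matrixP => i j; rewrite [RHS]mxE.
  have -> : (P *m K) i j = (P *m col j K) i 0 by rewrite !PE [col _ _ _ _]mxE.
  rewrite (fl (P *m col j K)) ?mxE//.
  - by move=> a la; rewrite PE la eqxx mul0r.
  - have BK : A^T *m P *m K = 0.
      by rewrite -[X in _ *m X *m _]Pt -trmx_mul mulmx_coker.
    by rewrite colE 2!mulmxA BK mul0mx.
have /submxP[w lw] : (l^T <= B^T)%MS.
  by rewrite submxE -Pl trmx_mul Pt -mulmxA PK mulmx0.
exists w^T => i li.
have -> : l = P *m A *m w^T by rewrite -[LHS]trmxK lw trmx_mul trmxK.
by rewrite -mulmxA PE li mul1r.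
Qed.

(* Every D A v with D positive diagonal has the form mu below, and
   D A = (A_D^+)^T A^T D A; so this says that |(A_D^+)^T| <= c for all D. *)
Definition scaling_bound {R : realType} {m n : nat} (A : 'M[R]_(m, n)) (c : R) :=
  forall (mu : 'cV[R]_m) (v : 'cV[R]_n),
    (forall i, exists2 d, 0 < d & mu i 0 = d * (A *m v) i 0) ->
    norm2 mu <= c * norm2 (A^T *m mu).

(** * From the scaling bound to the Hoffman bound *)

Section HoffmanBound.
Context {R : realType} {m n : nat} (A : 'M[R]_(m, n)) (c : R).
Hypotheses (c0 : 0 <= c) (Ac : scaling_bound A c).

Lemma scaling_bound_rows_free l : rows_free_on_supp A l ->
  norm2 l <= c * norm2 (A^T *m l).
Proof.
move=> /rows_free_interpolation [v vl].
pose w : 'cV[R]_m := \col_i if l i 0 == 0 then (A *m v) i 0 else 0.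
apply/ler_addgt0Pr => e e0.
pose W := c * norm2 (A^T *m w).
have W0 : 0 <= W by rewrite mulr_ge0 ?norm2_ge0.
(* As w carries the entries of A v off the support of l, l + t w is an admissible mu with factors 1
   on the support and t off it. This t makes the extra term t W at most e, even when W = 0. *)
pose t := e / (W + 1); have W1 : 0 < W + 1 by rewrite ltr_wpDl.
have t0 : 0 < t by rewrite divr_gt0.
have muE i : (l + t *: w) i 0 = if l i 0 == 0 then t * (A *m v) i 0 else l i 0.
  rewrite mxE [X in _ + X]mxE [w i 0]mxE.
  by case: eqP => [->|]; rewrite ?add0r ?mulr0 ?addr0.
have le_l : norm2 l <= norm2 (l + t *: w).
  apply/le_norm2/le_dot => i; rewrite muE.
  by case: eqP => [->|//]; rewrite mulr0 -expr2 sqr_ge0.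
apply: le_trans le_l _; apply: (le_trans (Ac (l + t *: w) v _)) => [i|].
  rewrite muE; case: eqP => [_|/eqP/vl ->]; first by exists t.
  by exists 1 => //; rewrite mul1r.
rewrite mulmxDr -scalemxAr.
apply: le_trans (ler_wpM2l c0 (ler_norm2D _ _)) _.
rewrite mulrDr lerD2l norm2Z gtr0_norm// mulrCA -/W /t mulrAC ler_pdivrMr//.
by rewrite ler_pM2l// lerDl.
Qed.

Lemma penalty_dist_le b x (p : 'cV[R]_n) e : 0 < e -> polyhedron A b p ->
  exists2 z, norm2 (x - z) <= c * norm2 (excess A b x) &
    dot (excess A b z) (excess A b z) <= e * dot (x - p) (x - p).
Proof.
move=> e0 /(@penalty_argmin _ _ _ A b x e p e0) [z zE zp].
exists z => //; set u := x - z.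
(* The multiplier (A z - b)_+ / e is replaced by one on independent rows; its support can only
   shrink, so it still meets only constraints violated at z. *)
have [|l [l0 lsupp lE lfree]] := @conic_caratheodory _ _ _ A (e^-1 *: excess A b z).
  by move=> i; rewrite mxE mulr_ge0 ?pospart_ge0// invr_ge0 ltW.
have uE : u = A^T *m l.
  by rewrite lE -scalemxAr -zE scalerA mulVf ?scale1r// gt_eqF.
(* Where l_i is nonzero, b_i <= (A z)_i, hence (A u)_i <= (A x - b)_i. *)
have uu : dot u u <= dot l (excess A b x).
  rewrite {1}uE dot_mulmx; apply: le_dot => i.
  have [->|li] := eqVneq (l i 0) 0; first by rewrite !mul0r.
  apply: ler_wpM2l => //.
  have : (e^-1 *: excess A b z) i 0 != 0 by apply: contra_neq li => /lsupp.
  rewrite mxE mulf_eq0 negb_or => /andP[_ zi].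
  have bz : b i 0 <= (A *m z) i 0.
    by rewrite -subr_ge0 leNgt; apply: contra zi => zi; rewrite excessE max_r ?ltW.
  rewrite excessE (mulmxBr A x) le_max; apply/orP; left.
  by rewrite mxE [X in _ + X]mxE lerD2l lerN2.
have [->|u0] := eqVneq u 0; first by rewrite norm20 mulr_ge0 ?norm2_ge0.
have nu : 0 < norm2 u by rewrite lt0r norm2_eq0 u0 norm2_ge0.
rewrite -(ler_pM2l nu) -expr2 norm2_sqr.
apply: le_trans uu _; apply: le_trans (cauchy_schwarz _ _) _.
rewrite mulrCA mulrA ler_wpM2r ?norm2_ge0// uE.
exact: scaling_bound_rows_free.
Qed.

(** The radius c |(A x - b)_+| does not depend on e, so the penalised points all lie in one ball
    while their excess tends to 0. The minimum of the excess over that ball is therefore 0, and a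
    minimiser is feasible. *)
Lemma polyhedron_near b x (p : 'cV[R]_n) : polyhedron A b p ->
  exists2 z, polyhedron A b z & norm2 (x - z) <= c * norm2 (excess A b x).
Proof.
move=> pP.
have [||z zB zmin] := @ball_argmin R n (fun z => dot (excess A b z) (excess A b z))
    x (c * norm2 (excess A b x)).
- by rewrite mulr_ge0 ?norm2_ge0.
- exact: continuous_excess.
exists z => //; apply/polyhedronP/eqP; rewrite eq_le dotvv_ge0 andbT.
apply/ler_addgt0Pr => e e0; rewrite add0r.
have K1 : 0 < dot (x - p) (x - p) + 1 by rewrite ltr_wpDl ?dotvv_ge0.
have [|w /zmin zw wp] := @penalty_dist_le b x p (e / (dot (x - p) (x - p) + 1)) _ pP.
  by rewrite divr_gt0.
apply: (le_trans zw); apply: (le_trans wp).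
by rewrite mulrAC ler_pdivrMr// ler_pM2l// lerDl.
Qed.

Lemma hoffman_le : (hoffman A <= c%:E)%E.
Proof.
apply: ge_ereal_sup => _ [b [x [[p [s s0 bE]] xP ->]]].
have pP : polyhedron A b p by move=> i; rewrite bE [leRHS]mxE lerDl; apply: s0.
have [z zP zx] := @polyhedron_near b x p pP.
have ex : 0 < norm2 (excess A b x).
  rewrite lt0r norm2_ge0 norm2_eq0 andbT; apply/eqP => e0.
  by apply: xP; apply/polyhedronP; rewrite e0 dot0l.
rewrite lee_fin ler_pdivrMr//; apply: le_trans zx.
apply: ge_inf; last by exists z.
by exists 0 => _ [v _ <-]; exact: norm2_ge0.
Qed.

End HoffmanBound.

(** * Operator norm and transposition *)

Section OperatorNorm.
Context {R : realType} {p q : nat} (M : 'M[R]_(p, q)).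

Lemma has_sup_opnorm :
  has_sup [set norm2 (M *m x) | x in [set x : 'cV[R]_q | norm2 x <= 1]].
Proof.
split; first by exists (norm2 (M *m 0)); exists 0; rewrite //= norm20.
(* The squared Frobenius norm, an upper bound by Cauchy-Schwarz on each row. *)
pose F := \sum_i dot (row i M)^T (row i M)^T.
have F0 : 0 <= F by apply: sumr_ge0 => i _; exact: dotvv_ge0.
exists (Num.sqrt F) => _ [x /= x1 <-].
rewrite norm2_le ?sqrtr_ge0// sqr_sqrtr//; apply: ler_sum => i _.
have -> : (M *m x) i 0 = dot (row i M)^T x.
  by rewrite mxE; apply: eq_bigr => j _; rewrite !mxE.
rewrite -expr2; apply: le_trans (dot_sqr_le _ _) _.
by rewrite ler_piMr ?dotvv_ge0// -norm2_sqr expr_le1 ?norm2_ge0.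
Qed.

Lemma opnorm_ge0 : 0 <= opnorm M.
Proof.
apply: le_trans (ub_le_sup (has_sup_opnorm).2 _); last first.
  by exists 0 => //=; rewrite norm20.
exact: norm2_ge0.
Qed.

Lemma norm2_mulmx_le x : norm2 (M *m x) <= opnorm M * norm2 x.
Proof.
have [->|x0] := eqVneq x 0; first by rewrite mulmx0 !norm20 mulr0.
have nx : 0 < norm2 x by rewrite lt0r norm2_eq0 x0 norm2_ge0.
rewrite -ler_pdivrMr// mulrC.
have -> : (norm2 x)^-1 * norm2 (M *m x) = norm2 (M *m ((norm2 x)^-1 *: x)).
  by rewrite -scalemxAr norm2Z gtr0_norm// invr_gt0.
apply: ub_le_sup; first exact: has_sup_opnorm.2.
by eexists; last reflexivity; rewrite /= norm2Z gtr0_norm ?invr_gt0// mulVf ?gt_eqF.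
Qed.

Lemma opnorm_le c : (forall x, norm2 x <= 1 -> norm2 (M *m x) <= c) -> opnorm M <= c.
Proof.
by move=> h; apply: ge_sup; [exact: has_sup_opnorm.1|move=> _ [x /h xc <-]].
Qed.

(** This follows from |M^T x|^2 = (x, M M^T x) <= |x| |M| |M^T x|. *)
Lemma norm2_trmx_mulmx_le x : norm2 (M^T *m x) <= opnorm M * norm2 x.
Proof.
have [->|y0] := eqVneq (M^T *m x) 0.
  by rewrite norm20 mulr_ge0 ?opnorm_ge0 ?norm2_ge0.
have ny : 0 < norm2 (M^T *m x) by rewrite lt0r norm2_eq0 y0 norm2_ge0.
rewrite -(ler_pM2l ny) -expr2 norm2_sqr dot_mulmx.
apply: le_trans (cauchy_schwarz _ _) _; rewrite mulrC mulrA.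
by rewrite ler_wpM2r ?norm2_ge0// mulrC norm2_mulmx_le.
Qed.

End OperatorNorm.

Lemma diag_mulE {R : realType} {m : nat} (d : 'rV[R]_m) (u : 'cV[R]_m) i :
  (diag_mx d *m u) i 0 = d 0 i * u i 0.
Proof. by rewrite mul_diag_mx mxE. Qed.

(** * Weighted pseudoinverses *)

Section WeightedPinv.
Context {R : realType} {m n : nat} (A : 'M[R]_(m, n)).
Hypothesis hA : \rank A = n.

Lemma col_rank_linv : exists B : 'M[R]_(n, m), B *m A = 1%:M.
Proof. by apply/row_fullP; rewrite /row_full hA. Qed.

Section Weight.
Variable d : 'rV[R]_m.
Hypothesis d0 : forall i, 0 < d 0 i.
Let D := diag_mx d.
Let N := A^T *m D *m A.

Lemma normal_mx_tr : N^T = N.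
Proof. by rewrite /N !trmx_mul trmxK tr_diag_mx mulmxA. Qed.

(** For r in the kernel, 0 = (D A r, A r) is a sum of terms d_i (A r)_i^2 with d_i > 0, so A r = 0,
    and a left inverse of A gives r = 0. *)
Lemma normal_mx_unit : N \in unitmx.
Proof.
rewrite -row_free_unit -kermx_eq0; apply/eqP/row_matrixP => i; rewrite row0.
set r := row i _; apply/(can_inj trmxK); rewrite trmx0.
have Nr : N *m r^T = 0.
  by rewrite -normal_mx_tr -trmx_mul /r -row_mul mulmx_ker row0 trmx0.
have : dot (D *m (A *m r^T)) (A *m r^T) = 0.
  by rewrite -dot_mulmx !mulmxA Nr dot0l.
move/eqP; rewrite psumr_eq0 => [/allP h|j _]; last first.
  by rewrite diag_mulE -mulrA; apply: mulr_ge0; [exact/ltW/d0|rewrite -expr2 sqr_ge0].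
have [B BA] := col_rank_linv.
rewrite -[LHS]mul1mx -BA -mulmxA (_ : A *m r^T = 0) ?mulmx0//.
apply/colP => j; rewrite [RHS]mxE; apply/eqP.
have := h j (mem_index_enum j).
by rewrite diag_mulE !mulf_eq0 (gt_eqF (d0 j))/= orbb.
Qed.

Lemma weighted_pinv_mulmx (x : 'cV[R]_n) : weighted_pinv A D *m (A *m x) = x.
Proof.
rewrite /weighted_pinv !mulmxA -!(mulmxA (invmx _)) -/N.
by rewrite mulKmx// normal_mx_unit.
Qed.

(** These are the normal equations: A_D^+ y solves the D-weighted least squares problem. *)
Lemma weighted_pinv_normal (y : 'cV[R]_m) :
  A^T *m (D *m (y - A *m (weighted_pinv A D *m y))) = 0.
Proof.
rewrite !mulmxBr /weighted_pinv -/N !mulmxA -/N.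
by rewrite mulmxV ?normal_mx_unit// mul1mx subrr.
Qed.

Lemma trmx_weighted_pinv (v : 'cV[R]_n) :
  (weighted_pinv A D)^T *m (A^T *m (D *m (A *m v))) = D *m (A *m v).
Proof.
rewrite /weighted_pinv -/N !trmx_mul trmxK trmx_inv normal_mx_tr tr_diag_mx.
by rewrite !mulmxA -(mulmxA _ A^T) -(mulmxA _ _ A) -/N mulmxKV ?normal_mx_unit.
Qed.

End Weight.

Lemma scaling_bound_opnorm c :
  (forall d : 'rV[R]_m, (forall i, 0 < d 0 i) ->
    opnorm (weighted_pinv A (diag_mx d)) <= c) ->
  scaling_bound A c.
Proof.
move=> Ac mu v muP.
(* The factors that witness the admissibility of mu form the diagonal of D. *)
have /choice[f fP] : forall i, exists t, 0 < t /\ mu i 0 = t * (A *m v) i 0.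
  by move=> i; have [t] := muP i; exists t.
pose d := \row_i f i; have d0 i : 0 < d 0 i by rewrite mxE (fP i).1.
have -> : mu = diag_mx d *m (A *m v).
  by apply/colP => i; rewrite diag_mulE mxE (fP i).2.
rewrite -{1}(trmx_weighted_pinv d d0); apply: le_trans (norm2_trmx_mulmx_le _ _) _.
by rewrite ler_wpM2r ?norm2_ge0// Ac.
Qed.

End WeightedPinv.

(** * Signature matrices and the choice of signs *)

Lemma scaling_bound_signature {R : realType} {m n : nat} (A : 'M[R]_(m, n)) c S :
  signature_mxs R m S -> scaling_bound A c -> scaling_bound (S *m A) c.
Proof.
move=> [s /= s1 <-] Ac mu v muP.
have ss i : s 0 i * s 0 i = 1 by case: (s1 i) => ->; ring.
(* The bound for A is applied to S mu: S is an isometry, (S A)^T mu = A^T (S mu), and mu = D S A v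
   becomes S mu = D A v because S^2 = 1. *)
have -> : norm2 mu = norm2 (diag_mx s *m mu).
  congr Num.sqrt; apply: eq_bigr => i _.
  by rewrite diag_mulE exprMn (expr2 (s 0 i)) ss mul1r.
rewrite trmx_mul tr_diag_mx -mulmxA; apply: (Ac _ v) => i.
have [d d0 muE] := muP i; exists d => //.
by rewrite diag_mulE muE -mulmxA diag_mulE mulrCA (mulrA (s 0 i)) ss mul1r.
Qed.

(** Indexing signs by a finite type lets a maximiser be picked by finiteness. *)
Definition sign_mx {R : realType} {m : nat} (s : {ffun 'I_m -> bool}) : 'M[R]_m :=
  diag_mx (\row_i (-1) ^+ s i).

Lemma sign_mx_signature {R : realType} {m : nat} (s : {ffun 'I_m -> bool}) :
  signature_mxs R m (sign_mx s).
Proof.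
by eexists; last reflexivity; move=> i; rewrite mxE; case: (s i); [left|right].
Qed.

(* The witness is x = A_D^+ y with right-hand side b = 0: the signs are those of
   the residual r = y - A x, completed where r vanishes by those of any v with
   x = A^T v. Since A^T D r = 0, every z in the cone S A z <= 0 has (A z)_i = 0
   when r_i <> 0, whence <x, z> = <v, A z> <= 0 and the nearest point to x is 0. *)
Lemma weighted_pinv_le_hoffman {R : realType} {m n : nat} (A : 'M[R]_(m, n))
    (d : 'rV[R]_m) (y : 'cV[R]_m) : \rank A = n -> (forall i, 0 < d 0 i) ->
  norm2 y <= 1 -> weighted_pinv A (diag_mx d) *m y != 0 ->
  exists s, ((norm2 (weighted_pinv A (diag_mx d) *m y))%:E <=
             hoffman (sign_mx s *m A))%E.
Proof.
move=> hA d0 y1; set x := _ *m y => x0.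
have [B BA] := col_rank_linv A hA.
pose v := B^T *m x; pose r := y - A *m x.
have Av : A^T *m v = x by rewrite mulmxA -trmx_mul BA trmx1 mul1mx.
pose s := [ffun i => if r i 0 == 0 then v i 0 < 0 else r i 0 < 0].
exists s; pose SA := sign_mx s *m A.
have SAE (z : 'cV[R]_n) i : (SA *m z) i 0 = (-1) ^+ s i * (A *m z) i 0.
  by rewrite /SA -mulmxA diag_mulE mxE.
have rE i : r i 0 = (-1) ^+ s i * `|r i 0|.
  rewrite ffunE; have [->|_] := eqVneq (r i 0) 0; first by rewrite normr0 mulr0.
  exact: realEsign (num_real _).
have vE i : r i 0 = 0 -> v i 0 = (-1) ^+ s i * `|v i 0|.
  by move=> ri; rewrite ffunE ri eqxx; exact: realEsign (num_real _).
have xz z : polyhedron SA 0 z -> dot x z <= 0.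
  move=> zP.
  have sAz i : (-1) ^+ s i * (A *m z) i 0 <= 0.
    by rewrite -SAE; have := zP i; rewrite [X in _ <= X]mxE.
  have term_le0 i : (diag_mx d *m r) i 0 * (A *m z) i 0 <= 0.
    rewrite diag_mulE rE -mulrA; apply: mulr_ge0_le0; first exact/ltW/d0.
    by rewrite mulrAC mulr_le0_ge0.
  (* The terms of (D r, A z) = 0 are all nonpositive, so each of them vanishes. *)
  have Az i : r i 0 != 0 -> (A *m z) i 0 = 0.
    move=> ri; have : dot (diag_mx d *m r) (A *m z) = 0.
      by rewrite -dot_mulmx /r weighted_pinv_normal// dot0l.
    move=> /eqP; rewrite -oppr_eq0 -sumrN psumr_eq0 => [|j _]; last first.
      by rewrite oppr_ge0.
    move=> /allP /(_ i (mem_index_enum i)).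
    by rewrite oppr_eq0 diag_mulE !mulf_eq0 (gt_eqF (d0 i)) (negbTE ri) => /eqP.
  rewrite -Av dot_mulmx; apply: sumr_le0 => i _.
  have [ri|ri] := eqVneq (r i 0) 0; last by rewrite Az// mulr0.
  by rewrite vE// mulrAC mulr_le0_ge0.
have P0 : polyhedron SA 0 0 by move=> i; rewrite mulmx0.
have dist_x : norm2 x <= dist x (polyhedron SA 0).
  apply: lb_le_inf; first by eexists; exists 0.
  move=> _ [z /xz xz0 <-]; apply: le_norm2.
  rewrite !(dotDl, dotDr, dotNl, dotNr) (dotC z x).
  by have := dotvv_ge0 z; lra.
have xP : ~ polyhedron SA 0 x.
  move=> /xz xx; move/eqP: x0; apply; apply: dotvv_eq0.
  by apply/eqP; rewrite eq_le xx dotvv_ge0.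
have ex0 : 0 < norm2 (pospart (SA *m x - 0)).
  rewrite lt0r norm2_ge0 norm2_eq0 andbT; apply/eqP => e0.
  by apply: xP; apply/polyhedronP; rewrite /excess e0 dot0l.
(* Entrywise, (S A x)_i = s_i y_i - |r_i|, whose positive part is at most |y_i|. *)
have ex1 : norm2 (pospart (SA *m x - 0)) <= 1.
  apply: le_trans y1; apply: le_norm2; apply: le_dot => i.
  rewrite -/(excess _ _ _) excessE [X in _ - X]mxE subr0 SAE.
  have ss : (-1) ^+ s i * (-1) ^+ s i = 1 :> R by rewrite -expr2 sqrr_sign.
  have -> : (A *m x) i 0 = y i 0 - r i 0.
    by rewrite /r; move: (A *m x) => w; rewrite !mxE; ring.
  have -> : y i 0 * y i 0 = ((-1) ^+ s i * y i 0) ^+ 2.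
    by rewrite exprMn sqrr_sign mul1r expr2.
  have -> : (-1) ^+ s i * (y i 0 - r i 0) = (-1) ^+ s i * y i 0 - `|r i 0|.
    by rewrite {1}rE mulrBr mulrA ss mul1r.
  set a := (-1) ^+ s i * y i 0.
  have := normr_ge0 (r i 0); move: `|r i 0| => t t0.
  case: (leP (a - t) 0) => at0; first by rewrite mulr0 sqr_ge0.
  by rewrite expr2; apply: ler_pM; rewrite ?gerBl// ltW.
apply: (@le_trans _ _ (dist x (polyhedron SA 0) / norm2 (pospart (SA *m x - 0)))%:E).
  rewrite lee_fin ler_pdivlMr//; apply: le_trans dist_x.
  by rewrite ler_piMr ?norm2_ge0.
apply: ereal_sup_ubound; exists 0, x; split=> //.
by exists 0, 0 => [i|]; rewrite ?mxE// mulmx0 addr0.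
Qed.

(** * Equality and attainment *)

Theorem theorem1 (R : realType) (m n : nat) (hm : (0 < m)%N) (hn : (0 < n)%N)
    (A : 'M[R]_(m, n)) (hA : \rank A = n) :
  is_max [set hoffman (S *m A) | S in signature_mxs R m] (chi A).
Proof.
have chi_ge D : posdiag_mxs R m D -> ((opnorm (weighted_pinv A D))%:E <= chi A)%E.
  by move=> DP; apply: ereal_sup_ubound; exists D.
have one_posdiag : posdiag_mxs R m (diag_mx (const_mx 1)).
  by eexists; last reflexivity; move=> i; rewrite mxE.
have hoffman_le_chi S : signature_mxs R m S -> (hoffman (S *m A) <= chi A)%E.
  (* The weight D = I excludes the value -oo for [chi A] and makes a finite c nonnegative. *)
  move=> SP; have := chi_ge _ one_posdiag; case E : (chi A) => [c| |] // h1; last first.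
    by rewrite leey.
  apply: hoffman_le; first by move: h1; rewrite lee_fin; exact: le_trans (opnorm_ge0 _).
  apply: scaling_bound_signature => //; apply: scaling_bound_opnorm => // d d0.
  by rewrite -lee_fin -E; apply: chi_ge; exists d.
split; last by move=> _ [S SP <-]; exact: hoffman_le_chi.
pose h s := hoffman (sign_mx s *m A).
have [s smax] : exists s, forall s', (h s' <= h s)%E.
  case: (@Order.TotalTheory.arg_maxP _ _ _ [ffun=> false] xpredT h) => // s _ hs.
  by exists s => s'; exact: hs.
exists (sign_mx s); first exact: sign_mx_signature.
apply/eqP; rewrite eq_le hoffman_le_chi/=; last exact: sign_mx_signature.
have pinv_le D y : posdiag_mxs R m D -> norm2 y <= 1 ->
    weighted_pinv A D *m y != 0 -> ((norm2 (weighted_pinv A D *m y))%:E <= h s)%E.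
  move=> [d d0 <-] y1 x0.
  have [s' xs'] := weighted_pinv_le_hoffman A d y hA d0 y1 x0.
  exact: le_trans xs' (smax s').
(* Since [pinv_le] says nothing when A_D^+ y = 0, that case rests on this bound, which also excludes
   [h s] = -oo. With n > 0 the all-ones vector e is nonzero, and y = k A e, scaled to norm at most
   1, has A_I^+ y = k e. *)
have hs0 : (0%:E <= h s)%E.
  pose e : 'cV[R]_n := const_mx 1; pose k := (norm2 (A *m e) + 1)^-1.
  have k1 : 0 < norm2 (A *m e) + 1 by rewrite ltr_wpDl ?norm2_ge0.
  have k0 : 0 < k by rewrite invr_gt0.
  have ke : weighted_pinv A (diag_mx (const_mx 1)) *m (k *: (A *m e)) = k *: e.
    by rewrite -scalemxAr weighted_pinv_mulmx// => i; rewrite mxE.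
  apply: le_trans (pinv_le _ (k *: (A *m e)) one_posdiag _ _); rewrite ?ke.
  - by rewrite lee_fin norm2_ge0.
  - by rewrite norm2Z gtr0_norm// mulrC ler_pdivrMr// mul1r lerDl.
  - rewrite scaler_eq0 gt_eqF//=; apply/eqP.
    move=> /(congr1 (fun w : 'cV[R]_n => w (Ordinal hn) 0)).
    by rewrite !mxE => /eqP; rewrite oner_eq0.
apply: ge_ereal_sup => _ [D DP <-]; rewrite -/(h s).
case: (h s) hs0 pinv_le => [c| |] // c0 pinv_le; last by rewrite leey.
rewrite lee_fin; apply: opnorm_le => y y1.
have [->|x0] := eqVneq (weighted_pinv A D *m y) 0; first by rewrite norm20 -lee_fin.
by rewrite -lee_fin; exact: pinv_le.
Qed.
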